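(* Let $\alpha,D>0$ and suppose that the linear system $\dot V(t)=-A(t,t_p)V(t)$, $t\ge0$, admits a predefined-time $\mu$ contraction with a positive function $\mu_{\alpha,D}(t,\tau)$ satisfying (B1)–(B3), i.e. its evolution operator satisfies $\|\Phi(t,\tau)\|\le\mu_{\alpha,D}(t,\tau)$ for all $t\ge\tau\ge 0$. Let $F:\mathbb{R}\times\mathbb{R}^n\to\mathbb{R}^n$ be continuous with $\|F(t,V(t))\|\le\widehat M$ for some $\widehat M>0$. Then the system $$\dot V(t)=-A(t,t_p)V(t)+F(t,V(t))$$ has a bounded solution. Furthermore, its solutions satisfy $\limsup_{t\to\infty}\|V(t)\|\le\dfrac{D\widehat M}{\alpha}$.
   Context: Here $V(t)\in\mathbb{R}^n$, $A(t,t_p)$ is an $n\times n$ matrix function, $t_p>0$ is fixed, and $\|\cdot\|$ is the Euclidean norm and the induced operator norm. The evolution operator $\Phi(t,\tau)$ of the linear system is defined by $V(t)=\Phi(t,\tau)V(\tau)$ for all its solutions. Conditions on the positive function $\mu_{\alpha,D}(t,\tau)$: (B1) $\lim_{t\to+\infty}\mu_{\alpha,D}(t,\tau)=0$, and $\mu_{\alpha,D}(t,\tau)$ is decreasing in $t$ and in $\alpha$ and increasing in $D$; (B2) $\alpha$ is sufficiently large that $\lim_{t\to t_p^+}\mu_{\alpha,D}(t,0)\le\epsilon$, where $\epsilon>0$ is small; (B3) with $\mu(t,\tau):=\mu_{1,1}(t,\tau)$, one has $\mu_{\alpha,D}(t,\tau)=D\,\mu^{\alpha}(t,\tau)$, $\mu(t,\tau)\mu(\tau,s)=\mu(t,s)$,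 and $\frac{\partial\mu(0,t)}{\partial t}\cdot\mu^{-1}(0,t)\ge1$. *)

(* Defs.v *)
From mathcomp Require Import all_boot all_order all_algebra.
From mathcomp Require Import all_classical all_reals all_analysis.
Import Order.TTheory GRing.Theory Num.Theory.
Import numFieldNormedType.Exports.

Set Implicit Arguments.
Unset Strict Implicit.
Unset Printing Implicit Defensive.

Local Open Scope classical_set_scope.
Local Open Scope ring_scope.

(* The library norm `|_| on matrices is the max norm. *)
Definition enorm (R : realType) (n : nat) (v : 'cV[R]_n) : R :=
  Num.sqrt (\sum_(i < n) v i 0 ^+ 2).

Definition opnorm (R : realType) (n : nat) (M : 'M[R]_n) : R :=
  sup [set enorm (M *m v) | v in [set v : 'cV[R]_n | enorm v <= 1]].

(* Derivative of f : [0, +oo[ -> W at t >= 0: two-sided for 0 < t, one-sided at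
   t = 0.  The values of f on negative reals are irrelevant. *)
Definition is_derive_ge0 (R : realType) (W : normedModType R)
    (f : R -> W) (t : R) (l : W) : Prop :=
  h^-1 *: (f (t + h) - f t) @[h --> within [set h | 0 <= t + h] 0^'] --> l.

(* V is a (classical) solution on [0, +oo[ of V' = G(t, V). *)
Definition solution (R : realType) (n : nat) (G : R -> 'cV[R]_n -> 'cV[R]_n)
    (V : R -> 'cV[R]_n) : Prop :=
  forall t, 0 <= t -> is_derive_ge0 V t (G t (V t)).

Definition linear_rhs (R : realType) (n : nat) (A : R -> R -> 'M[R]_n) (tp : R)
    (t : R) (v : 'cV[R]_n) : 'cV[R]_n := - (A t tp *m v).

Definition perturbed_rhs (R : realType) (n : nat) (A : R -> R -> 'M[R]_n)
    (tp : R) (F : R * 'cV[R]_n -> 'cV[R]_n) (t : R) (v : 'cV[R]_n)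
    : 'cV[R]_n := - (A t tp *m v) + F (t, v).

(* Phi is the evolution operator of V' = - A(t, tp) V: V(t) = Phi(t, tau) V(tau)
   for all solutions V.  No regularity is imposed on t |-> A(t, tp), so the
   first conjunct states that the initial value problems are solvable (automatic
   for continuous A), which is what makes the second one determine Phi. *)
Definition is_evolution_operator (R : realType) (n : nat)
    (A : R -> R -> 'M[R]_n) (tp : R) (Phi : R -> R -> 'M[R]_n) : Prop :=
  (forall tau v, 0 <= tau ->
     exists2 V, solution (linear_rhs A tp) V & V tau = v) /\
  (forall V, solution (linear_rhs A tp) V ->
     forall t tau, 0 <= t -> 0 <= tau -> V t = Phi t tau *m V tau).

(* A family mu alpha D t tau is considered for alpha, D > 0 and t, tau >= 0. *)
Definition mu_positive (R : realType) (mu : R -> R -> R -> R -> R) : Prop :=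
  forall a d t tau, 0 < a -> 0 < d -> 0 <= t -> 0 <= tau -> 0 < mu a d t tau.

(* The monotonicity conditions are non-strict and restricted to tau <= t: under
   mu_cocycle below, mu a d tau tau = d does not depend on
   a, and mu 1 1 t tau > 1 for t < tau makes mu a d t tau increasing in a. *)
Definition mu_decay_monotone (R : realType) (mu : R -> R -> R -> R -> R)
    : Prop :=
  [/\ forall a d tau, 0 < a -> 0 < d -> 0 <= tau ->
        mu a d t tau @[t --> +oo] --> (0 : R),
      forall a d tau s t, 0 < a -> 0 < d -> 0 <= tau -> tau <= s -> s <= t ->
        mu a d t tau <= mu a d s tau,
      forall a b d t tau, 0 < a -> a <= b -> 0 < d -> 0 <= tau -> tau <= t ->
        mu b d t tau <= mu a d t tau
    & forall a d e t tau, 0 < a -> 0 < d -> d <= e -> 0 <= tau -> tau <= t ->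
        mu a d t tau <= mu a e t tau].

Definition mu_small_after (R : realType) (mu : R -> R -> R -> R -> R)
    (alpha D tp eps : R) : Prop :=
  exists2 l : R, mu alpha D t 0 @[t --> tp^'+] --> l & l <= eps.

Definition mu_cocycle (R : realType) (mu : R -> R -> R -> R -> R) : Prop :=
  [/\ forall a d t tau, 0 < a -> 0 < d -> 0 <= t -> 0 <= tau ->
        mu a d t tau = d * (mu 1 1 t tau) `^ a,
      forall t tau s, 0 <= t -> 0 <= tau -> 0 <= s ->
        mu 1 1 t tau * mu 1 1 tau s = mu 1 1 t s
    & forall t, 0 <= t ->
        exists2 l : R, is_derive_ge0 (mu 1 1 0 : R -> R^o) t l
                     & 1 <= l * (mu 1 1 0 t)^-1].

Definition mu_contraction (R : realType) (n : nat) (Phi : R -> R -> 'M[R]_n)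
    (mu : R -> R -> R -> R -> R) (alpha D : R) : Prop :=
  forall t tau, 0 <= tau -> tau <= t -> opnorm (Phi t tau) <= mu alpha D t tau.

(* Main.v *)
Require Import Defs.
From mathcomp Require Import all_boot all_order all_algebra.
From mathcomp Require Import all_classical all_reals all_analysis.
From mathcomp Require Import ring lra.
Import Order.TTheory GRing.Theory Num.Theory.
Import numFieldNormedType.Exports.

(** The coefficient [A] is an arbitrary function of time, so the perturbed system is
    never solved directly.  The evolution operator absorbs [A]: its columns are
    solutions of the linear system, hence continuous, and [Phi t s] is invertible with
    inverse [Phi s t].  The substitution [V t = Phi t 0 *m W t] turns the perturbed system
    into [W' = Phi 0 t *m F (t, Phi t 0 *m W)], whose right-hand side is continuous and
    bounded over bounded times ([perturbed_solution_exists]).  Such an equation has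
    a global solution ([peano_global]): step functions built from
    Euler's method converge pointwise along an ultrafilter, and a discrete mean value estimate passes to the limit.

    Every solution satisfies, for [T >= 0],
    [enorm (V T) <= mu alpha D T 0 * enorm (V 0) + D * Mhat / alpha]
    ([contraction_bound]).  This is the variation of constants formula
    [V(T) = Phi(T,0) V(0) + int_0^T Phi(T,s) F(s,V(s)) ds] together with
    [int_0^T mu alpha D T s ds <= D / alpha]: by the cocycle property
    [mu alpha D T s = D (g(s) / g(T)) ^ alpha] with [g s = mu 1 1 0 s], and [g <= g']
    makes this at most the derivative of [(D / alpha) (g(s) / g(T)) ^ alpha].  The proof
    compares derivatives instead of integrals, since a derivative such as [g'] need not be
    integrable.  As [mu alpha D T 0] decreases to 0 when [T] grows, the bound shows
    both that every solution is bounded and that its limit superior is at most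
    [D * Mhat / alpha]. *)

Local Open Scope classical_set_scope.
Local Open Scope ring_scope.

(** * Euclidean and maximum norms *)

Lemma cauchy_schwarz_sum {R : realType} {n : nat} (a b : 'I_n -> R) :
  \sum_(i < n) a i * b i
    <= Num.sqrt (\sum_(i < n) a i ^+ 2) * Num.sqrt (\sum_(i < n) b i ^+ 2).
Proof.
set p := Num.sqrt (\sum_(i < n) a i ^+ 2).
set q := Num.sqrt (\sum_(i < n) b i ^+ 2).
have sq_ge0 (c : 'I_n -> R) : 0 <= \sum_(i < n) c i ^+ 2.
  by apply: sumr_ge0 => i _; exact: sqr_ge0.
have pE : \sum_(i < n) a i ^+ 2 = p ^+ 2 by rewrite sqr_sqrtr.
have qE : \sum_(i < n) b i ^+ 2 = q ^+ 2 by rewrite sqr_sqrtr.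
have p_ge0 : 0 <= p by exact: sqrtr_ge0.
have q_ge0 : 0 <= q by exact: sqrtr_ge0.
have zero (c : 'I_n -> R) : \sum_(i < n) c i ^+ 2 = 0 -> forall i, c i = 0.
  move=> /eqP; rewrite psumr_eq0; last by move=> i _; exact: sqr_ge0.
  by move=> /allP c0 i; apply/eqP; rewrite -sqrf_eq0 (implyP (c0 i _)) ?mem_index_enum.
have [pq0|pq0] := eqVneq (p * q) 0.
  rewrite pq0; move/eqP: pq0; rewrite mulf_eq0 => /orP[] /eqP z.
    by rewrite big1// => i _; rewrite (zero a) ?mul0r// pE z expr0n.
  by rewrite big1// => i _; rewrite (zero b) ?mulr0// qE z expr0n.
have pq_gt0 : 0 < p * q by rewrite lt_def pq0 mulr_ge0.
(* Cauchy-Schwarz is the nonnegativity of the squared norm of [q a - p b]. *)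
have : 0 <= \sum_(i < n) (q * a i - p * b i) ^+ 2 by exact: sq_ge0.
have -> : \sum_(i < n) (q * a i - p * b i) ^+ 2 =
    q ^+ 2 * p ^+ 2 + p ^+ 2 * q ^+ 2
    - (2 * p * q) * (\sum_(i < n) a i * b i).
  rewrite -[X in q ^+ 2 * X + _]pE -[X in _ + p ^+ 2 * X]qE.
  rewrite !mulr_sumr -big_split/= -sumrB.
  by apply: eq_bigr => i _; ring.
set s := \sum_(i < n) _ => h.
by rewrite -(ler_pM2l pq_gt0); nra.
Qed.

Lemma enorm_ge0 {R : realType} {n : nat} (v : 'cV[R]_n) : 0 <= enorm v.
Proof. exact: sqrtr_ge0. Qed.

Lemma sqr_enorm {R : realType} {n : nat} (v : 'cV[R]_n) :
  enorm v ^+ 2 = \sum_(i < n) v i 0 ^+ 2.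
Proof. by rewrite sqr_sqrtr// sumr_ge0// => i _; exact: sqr_ge0. Qed.

Definition dot {R : realType} {n : nat} (e x : 'cV[R]_n) : R :=
  \sum_(i < n) e i 0 * x i 0.

Lemma dot_le {R : realType} {n : nat} (e x : 'cV[R]_n) : dot e x <= enorm e * enorm x.
Proof. exact: cauchy_schwarz_sum. Qed.

Lemma dot_self {R : realType} {n : nat} (e : 'cV[R]_n) : dot e e = enorm e ^+ 2.
Proof. by rewrite sqr_enorm; apply: eq_bigr => i _; rewrite expr2. Qed.

Lemma enormZ {R : realType} {n : nat} (a : R) (v : 'cV[R]_n) :
  0 <= a -> enorm (a *: v) = a * enorm v.
Proof.
move=> a0; rewrite /enorm -[X in X * _]ger0_norm// -sqrtr_sqr -sqrtrM ?sqr_ge0//.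
congr Num.sqrt; rewrite mulr_sumr; apply: eq_bigr => i _.
by rewrite mxE exprMn.
Qed.

Lemma enorm_mulmx_le {R : realType} {n : nat} (M : 'M[R]_n) (v : 'cV[R]_n) :
  enorm (M *m v) <= Num.sqrt (\sum_(i < n) \sum_(j < n) M i j ^+ 2) * enorm v.
Proof.
rewrite -ler_sqr ?nnegrE ?mulr_ge0 ?sqrtr_ge0//.
rewrite exprMn !sqr_enorm sqr_sqrtr; last first.
  by apply: sumr_ge0 => i _; apply: sumr_ge0 => j _; exact: sqr_ge0.
rewrite mulr_suml; apply: ler_sum => i _; rewrite mxE.
have sq_ge0 (c : 'I_n -> R) : 0 <= \sum_(i < n) c i ^+ 2.
  by apply: sumr_ge0 => k _; exact: sqr_ge0.
rewrite -(sqr_sqrtr (sq_ge0 (M i))) -(sqr_sqrtr (sq_ge0 (v^~ 0))) -exprMn.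
rewrite -[X in X <= _]real_normK ?num_real// ler_sqr ?nnegrE ?mulr_ge0 ?sqrtr_ge0//.
rewrite ler_norml cauchy_schwarz_sum andbT lerNl -sumrN.
under eq_bigr do rewrite -mulNr.
apply: (le_trans (cauchy_schwarz_sum _ _)).
by under eq_bigr do rewrite sqrrN.
Qed.

(** The supremum of an unbounded set of reals is a default value, so the set
    defining [opnorm] must first be seen to be bounded: by the Frobenius norm, which
    dominates because Cauchy-Schwarz applies to each row. *)
Lemma enorm_opnorm_le {R : realType} {n : nat} (M : 'M[R]_n) (v : 'cV[R]_n) :
  enorm (M *m v) <= opnorm M * enorm v.
Proof.
have [v0|v0] := eqVneq (enorm v) 0.
  by rewrite v0 mulr0 (le_trans (enorm_mulmx_le M v))// v0 mulr0.
have v_gt0 : 0 < enorm v by rewrite lt_def v0 enorm_ge0.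
rewrite -ler_pdivrMr// mulrC -enormZ ?invr_ge0 ?enorm_ge0// scalemxAr.
apply: ub_le_sup; last first.
  by exists ((enorm v)^-1 *: v) => //=; rewrite enormZ ?invr_ge0 ?enorm_ge0// mulVf.
exists (Num.sqrt (\sum_(i < n) \sum_(j < n) M i j ^+ 2)) => _ [w /= w1 <-].
by rewrite (le_trans (enorm_mulmx_le M w))// ler_piMr ?sqrtr_ge0.
Qed.

Lemma mx_norm_leP {R : realType} {m n : nat} (x : 'M[R]_(m, n)) (c : R) :
  0 <= c -> reflect (forall i j, `|x i j| <= c) (`|x| <= c).
Proof.
move=> c0; apply: (iffP idP) => [xc i j|h].
  apply: le_trans xc; rewrite -[`|x|]/(mx_norm x) mx_normrE.
  exact: (le_bigmax _ (fun ij => `|x ij.1 ij.2|) (i, j)).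
rewrite -[`|x|]/(mx_norm x) mx_normrE.
by apply/bigmax_leP; split => // -[i j] _; exact: h.
Qed.

Lemma mx_norm_coord_le {R : realType} {m n : nat} (x : 'M[R]_(m, n)) i j :
  `|x i j| <= `|x|.
Proof. by apply/mx_norm_leP. Qed.

Lemma mx_norm_le_enorm {R : realType} {n : nat} (v : 'cV[R]_n) : `|v| <= enorm v.
Proof.
apply/mx_norm_leP; first exact: enorm_ge0.
move=> i j; rewrite (ord1 j) -sqrtr_sqr ler_wsqrtr//.
rewrite (bigD1 i)//= lerDl sumr_ge0// => k _; exact: sqr_ge0.
Qed.

Lemma mx_norm_mulmx_le {R : realType} {n : nat} (M : 'M[R]_n) (v : 'cV[R]_n) :
  `|M *m v| <= n%:R * `|M| * `|v|.
Proof.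
apply/mx_norm_leP; first by rewrite !mulr_ge0.
move=> i j; rewrite mxE (le_trans (ler_norm_sum _ _ _))//.
have -> : n%:R * `|M| * `|v| = \sum_(k < n) (`|M| * `|v|).
  by rewrite sumr_const card_ord -[RHS]mulr_natl mulrA.
by apply: ler_sum => k _; rewrite normrM ler_pM// mx_norm_coord_le.
Qed.

(** * Limits of matrix-valued functions *)

Lemma cvg_mxP {R : realType} {T : Type} {F : set_system T} {FF : Filter F} {m n : nat}
    (f : T -> 'M[R]_(m, n)) (l : 'M[R]_(m, n)) :
  (forall i j, f x i j @[x --> F] --> l i j) <-> f x @[x --> F] --> l.
Proof.
split=> [h|fl i j].
  apply/cvgrPdist_le => e e0.
  have : \forall x \near F, forall ij : 'I_m * 'I_n, `|l ij.1 ij.2 - f x ij.1 ij.2| <= e.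
    by apply: filter_forall => ij; move/cvgrPdist_le : (h ij.1 ij.2); exact.
  apply: filterS => x hx; apply/mx_norm_leP; first exact: ltW.
  by move=> i j; rewrite !mxE (hx (i, j)).
exact: (cvg_comp _ _ fl (@coord_continuous R m n i j l)).
Qed.

Lemma cvg_mulmx {R : realType} {T : Type} {F : set_system T} {FF : Filter F} {m n p : nat}
    (f : T -> 'M[R]_(m, n)) (g : T -> 'M[R]_(n, p)) (A : 'M[R]_(m, n))
    (B : 'M[R]_(n, p)) :
  f x @[x --> F] --> A -> g x @[x --> F] --> B ->
  f x *m g x @[x --> F] --> A *m B.
Proof.
move=> /cvg_mxP fA /cvg_mxP gB; apply/cvg_mxP => i j; rewrite mxE.
under eq_fun do rewrite mxE.
apply: cvg_big => [|k _]; last by apply: cvgM; [exact: fA|exact: gB].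
exact: add_continuous.
Qed.

Lemma cvg_det {R : realType} {T : Type} {F : set_system T} {FF : Filter F} {n : nat}
    (f : T -> 'M[R]_n) (A : 'M[R]_n) :
  f x @[x --> F] --> A -> \det (f x) @[x --> F] --> \det A.
Proof.
move=> /cvg_mxP fA; apply: cvg_big => [|s _]; first exact: add_continuous.
apply: cvgMr; apply: cvg_big => [|i _]; first exact: mul_continuous.
exact: fA.
Qed.

(** Cramer's rule expresses the inverse by determinants, so the continuity of
    determinants is enough. *)
Lemma cvg_invmx {R : realType} {T : Type} {F : set_system T} {FF : Filter F} {n : nat}
    (f : T -> 'M[R]_n) (A : 'M[R]_n) : (forall x, f x \in unitmx) -> A \in unitmx ->
  f x @[x --> F] --> A -> invmx (f x) @[x --> F] --> invmx A.
Proof.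
move=> f_unit A_unit fA.
have detA0 : \det A != 0 by rewrite -unitfE.
have invE (B : 'M[R]_n) : B \in unitmx -> invmx B = (\det B)^-1 *: \adj B.
  by rewrite /invmx => ->.
under eq_fun do rewrite invE//.
rewrite invE//; apply: cvgZ; first by apply: cvgV => //; exact: cvg_det.
apply/cvg_mxP => i j; rewrite mxE; under eq_fun do rewrite mxE.
apply: cvgMr; apply: cvg_det; apply/cvg_mxP => k l; rewrite !mxE.
under eq_fun do rewrite !mxE.
by move/cvg_mxP : fA; exact.
Qed.

(** * One-sided derivatives *)

Lemma max_ge0 {R : realType} (s : R) : 0 <= Num.max s 0.
Proof. by rewrite le_max lexx orbT. Qed.

(** This form makes no division, so it also covers the increment [s = t]; it is
    the one that Euler's method produces. *)
Lemma is_derive_ge0P {R : realType} {W : normedModType R} (f : R -> W) (t : R) (l : W) :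
  is_derive_ge0 f t l <->
  forall e, 0 < e -> exists2 d, 0 < d &
    forall s, 0 <= s -> `|s - t| < d -> `|f s - f t - (s - t) *: l| <= e * `|s - t|.
Proof.
split=> [fl e e0|h].
  move/cvgrPdist_le : fl => /(_ _ e0); rewrite near_withinE => /nbhs_ballP[d/= d0 dP].
  exists d => // s s0 std.
  have [->|st] := eqVneq s t; first by rewrite !subrr scale0r subrr !normr0 mulr0.
  have st0 : s - t != 0 by rewrite subr_eq0.
  have := dP (s - t); rewrite /ball/= sub0r normrN => /(_ std st0).
  rewrite [t + _]addrC subrK => /(_ s0) H.
  have -> : f s - f t - (s - t) *: l = (s - t) *: ((s - t)^-1 *: (f s - f t) - l).
    by rewrite (scalerBr (s - t)) scalerA mulfV// scale1r.
  by rewrite normrZ mulrC ler_wpM2r// distrC.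
apply/cvgrPdist_le => e e0; have [d d0 dP] := h e e0.
rewrite near_withinE; apply/nbhs_ballP; exists d => //= k.
rewrite /ball/= sub0r normrN => kd k0 tk0.
have := dP _ tk0; rewrite [t + k]addrC addrK => /(_ kd) H.
have -> : l - k^-1 *: (f (k + t) - f t) = - (k^-1 *: (f (k + t) - f t - k *: l)).
  by rewrite [X in _ = - X]scalerBr scalerA mulVf// scale1r opprB.
by rewrite normrN normrZ normfV ler_pdivrMl ?normr_gt0// mulrC.
Qed.

Lemma eq_is_derive_ge0 {R : realType} {W : normedModType R} (f g : R -> W) (t : R) (l : W) :
  0 <= t -> (forall s, 0 <= s -> f s - f t = g s - g t) ->
  is_derive_ge0 f t l -> is_derive_ge0 g t l.
Proof.
move=> t0 fg /is_derive_ge0P fl; apply/is_derive_ge0P => e /fl[d d0 dP].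
by exists d => // s s0; rewrite -fg//; exact: dP.
Qed.

(** Values at negative times are unconstrained, so continuity on the half-line is
    expressed by composing with the retraction [t |-> max t 0], which is
    1-Lipschitz and makes the composite continuous on the whole line. *)
Lemma is_derive_ge0_continuous {R : realType} {W : normedModType R} (f : R -> W) :
  (forall t, 0 <= t -> exists l, is_derive_ge0 f t l) ->
  continuous (fun t : R => f (Num.max t 0)).
Proof.
move=> df t; have m0 (s : R) : 0 <= Num.max s 0 by exact: max_ge0.
have [l /is_derive_ge0P/(_ 1 ltr01)[d d0 dP]] := df _ (m0 t).
apply/cvgrPdist_le => e e0; apply/nbhs_ballP.
have L0 : 0 < `|l| + 1 by rewrite ltr_wpDl.
exists (Num.min d (e / (`|l| + 1))); first by rewrite /= lt_min d0 divr_gt0.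
move=> s; rewrite /ball/= lt_min distrC => /andP[sd se].
have lip : `|Num.max s 0 - Num.max t 0| <= `|s - t|.
  have [s0|s0] := leP s 0; have [t0|t0] := leP t 0; rewrite ?subrr ?normr0//.
    by rewrite sub0r normrN (gtr0_norm t0) ler0_norm; lra.
  by rewrite subr0 !ger0_norm; lra.
rewrite distrC -(subrK ((Num.max s 0 - Num.max t 0) *: l) (f _ - f _)).
apply: (le_trans (ler_normD _ _)); rewrite normrZ.
apply: (@le_trans _ _ (`|s - t| * (`|l| + 1))); last first.
  by rewrite -ler_pdivlMr// ltW.
rewrite mulrDr addrC lerD ?ler_wpM2r//.
by rewrite mulr1 (le_trans (dP _ (m0 s) (le_lt_trans lip sd)))// mul1r.
Qed.

Lemma cvg_within_ge0 {R : realType} {W : normedModType R} (f : R -> W) (t : R) :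
  0 <= t -> continuous (fun s : R => f (Num.max s 0)) ->
  f (t + h) @[h --> within [set h | 0 <= t + h] 0^'] --> f t.
Proof.
move=> t0 /(_ t)/cvgrPdist_le fc; apply/cvgrPdist_le => e /fc/nbhs_ballP[d/= d0 dP].
rewrite near_withinE; apply/nbhs_ballP; exists d => //= h.
rewrite /ball/= sub0r normrN => hd _ th0.
have := dP (t + h); rewrite /ball/= opprD addNKr normrN !max_l//; exact.
Qed.

(** A Leibniz rule in which [M] need only be continuous, and differentiable in
    the direction of the single vector [y t]:
    [M(t+h) y(t+h) - M(t) y(t) = (M(t+h) - M(t)) y(t) + M(t+h) (y(t+h) - y(t))].
    Both factors of the evolution operator can thus be treated through individual
    solutions of the linear system. *)
Lemma is_derive_ge0_mulmx {R : realType} {n : nat} (M : R -> 'M[R]_n)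
    (y : R -> 'cV[R]_n) (t : R) (p q : 'cV[R]_n) :
  0 <= t -> continuous (fun s : R => M (Num.max s 0)) ->
  is_derive_ge0 (fun s => M s *m y t) t p -> is_derive_ge0 y t q ->
  is_derive_ge0 (fun s => M s *m y s) t (p + M t *m q).
Proof.
move=> t0 Mc Mp yq; rewrite /is_derive_ge0.
have -> : (fun h => h^-1 *: (M (t + h) *m y (t + h) - M t *m y t)) =
    (fun h => h^-1 *: (M (t + h) *m y t - M t *m y t)
              + M (t + h) *m (h^-1 *: (y (t + h) - y t))).
  apply/funext => h; rewrite -scalemxAr -scalerDr mulmxBr; congr (_ *: _).
  by rewrite [RHS]addrC addrA subrK.
apply: cvgD; first exact: Mp.
by apply: cvg_mulmx => //; exact: cvg_within_ge0.
Qed.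

Lemma is_derive_ge0_dot {R : realType} {n : nat} (e : 'cV[R]_n) (f : R -> 'cV[R]_n)
    (t : R) (l : 'cV[R]_n) :
  is_derive_ge0 f t l -> is_derive_ge0 (fun s => dot e (f s) : R^o) t (dot e l).
Proof.
move=> /cvg_mxP fl.
have lim : \sum_(i < n) e i 0 * (h^-1 *: (f (t + h) - f t)) i 0
    @[h --> within [set h | 0 <= t + h] 0^'] --> dot e l.
  apply: cvg_big => [|i _]; first exact: add_continuous.
  by apply: cvgMr; exact: fl.
apply: cvg_trans lim; apply: near_eq_cvg; apply: nearW => h /=.
rewrite /dot -sumrB scaler_sumr; apply: eq_bigr => i _.
by rewrite !mxE -[RHS]/(_ * _); ring.
Qed.

Lemma is_derive_ge0_is_derive {R : realType} (f : R -> R) (t l : R) :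
  0 < t -> is_derive_ge0 (f : R -> R^o) t l -> is_derive t 1 f l.
Proof.
move=> t0 fl.
have : h^-1 *: (f (h *: 1 + t) - f t) @[h --> 0^'] --> l.
  apply: cvg_trans fl => P; rewrite /fmap/= => /nbhs_ballP[d/= d0 dP].
  apply/nbhs_ballP; exists (Num.min d t); first by rewrite /= lt_min d0.
  move=> h; rewrite /ball/= lt_min => /andP[hd ht] h0.
  rewrite [h *: 1]mulr1 [h + t]addrC; apply: dP => //=.
  by move: ht; rewrite sub0r normrN ltr_norml => /andP[]; lra.
by move=> h; split; [apply/cvg_ex; exists l|exact: (cvg_lim _ h)].
Qed.

Lemma ge0_derive_le {R : realType} (h : R -> R) (T : R) :
  0 <= T -> continuous (fun s : R => h (Num.max s 0)) ->
  (forall t : R, 0 < t -> t < T -> exists2 l, is_derive t 1 h l & 0 <= l) ->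
  h 0 <= h T.
Proof.
move=> T0 hc dh.
have drv x : x \in `]0, T[ -> exists2 l, is_derive x 1 h l & 0 <= l.
  by rewrite in_itv/= => /andP[x0 xT]; exact: dh.
apply: (@ger0_derive1_le_cc _ h 0 T); rewrite ?in_itv/= ?lexx//.
- by move=> x /drv[l [dl _] _].
- by move=> x /drv[l dl l0]; rewrite derive1E (@derive_val _ _ _ _ _ _ _ dl).
- have : {within `[0, T], continuous (fun s : R => h (Num.max s 0))}.
    exact: continuous_subspaceT.
  apply: subspace_eq_continuous => x.
  by rewrite inE/= in_itv/= => /andP[x0 _]; rewrite /from_subspace/= max_l.
- by rewrite T0.
Qed.

Lemma is_derive_powR_comp {R : realType} (g : R -> R) (a t l : R) :
  0 < g t -> is_derive t 1 g l ->
  is_derive t 1 (fun s => g s `^ a) (a * g t `^ (a - 1) * l).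
Proof.
move=> g0 [dg <-]; have [dp pE] := is_derive1_powR a g0.
split.
  have dc : differentiable (((@powR R)^~ a) \o g) t.
    by apply: differentiable_comp; apply/derivable1_diffP.
  exact/derivable1_diffP.
by have := derive1_comp dg dp; rewrite !derive1E pE.
Qed.

Lemma cvg_powR {R : realType} {T : Type} {F : set_system T} {FF : Filter F}
    (f : T -> R) (x a : R) :
  0 < x -> f y @[y --> F] --> x -> f y `^ a @[y --> F] --> x `^ a.
Proof.
move=> x0 fx; apply: (@cvg_comp _ _ _ f ((@powR R)^~ a) _ (nbhs x)) => //.
have [dp _] := is_derive1_powR a x0.
have /differentiable_continuous : differentiable ((@powR R)^~ a) x by apply/derivable1_diffP.
exact.
Qed.

(** * Global solutions by Euler's method *)

(** In a compact set a filter has a cluster point, and an ultrafilter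
    converges to each of its cluster points. *)
Lemma ultra_bounded_cvg {R : realType} {T : Type} {U : set_system T} (UU : UltraFilter U)
    (f : T -> R) (M : R) :
  (forall x, `|f x| <= M) -> exists l : R, f x @[x --> U] --> l.
Proof.
move=> fM.
have fU : (f x @[x --> U]) `[- M, M]%classic.
  by apply: (@filterE _ U) => x; rewrite /= in_itv/= -ler_norml.
have [l [_ lf]] := segment_compact _ fU.
exists l => B lB.
have [//|nB] := in_ultra_setVsetC (f @^-1` B) UU.
by have [y [/= nBy By]] := lf (~` B) B nB lB.
Qed.

(** A single ultrafilter serves for all points at once; this replaces the extraction
    of a diagonal subsequence in the theorem of Ascoli. *)
Lemma pointwise_ultra_limit {R : realType} {T : Type} {n : nat}
    (u : nat -> T -> 'cV[R]_n) :
  (forall t, exists M, forall k, `|u k t| <= M) ->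
  exists W : T -> 'cV[R]_n, exists U : set_system nat,
    [/\ ProperFilter U, \oo `<=` U & forall t, u k t @[k --> U] --> W t].
Proof.
move=> ub; have [U [UU ooU]] := @ultraFilterLemma nat \oo _.
have lim t : exists l : 'cV[R]_n, u k t @[k --> U] --> l.
  have [M uM] := ub t.
  have /choice[l lP] : forall i, exists l : R, u k t i 0 @[k --> U] --> l.
    move=> i; apply: (@ultra_bounded_cvg _ _ _ UU _ M) => k.
    exact: le_trans (mx_norm_coord_le _ _ _) (uM k).
  by exists (\col_i l i); apply/cvg_mxP => i j; rewrite (ord1 j) mxE.
have [W WP] := choice lim.
by exists W, U; split=> //; exact: ultra_proper.
Qed.

Fixpoint euler {R : realType} {n : nat} (H : R * 'cV[R]_n -> 'cV[R]_n) (w0 : 'cV[R]_n)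
    (h : R) (j : nat) : 'cV[R]_n :=
  if j is j'.+1 then euler H w0 h j' + h *: H (j'%:R * h, euler H w0 h j') else w0.

(** A discrete mean value inequality, which stands in for the integral form of the
    differential equation; [c = 0] gives a bound on the speed. *)
Lemma euler_increment {R : realType} {n : nat} (H : R * 'cV[R]_n -> 'cV[R]_n)
    (w0 : 'cV[R]_n) (h : R) (c : 'cV[R]_n) (e : R) (i j : nat) :
  0 <= h -> (i <= j)%N ->
  (forall l, (i <= l < j)%N -> `|H (l%:R * h, euler H w0 h l) - c| <= e) ->
  `|euler H w0 h j - euler H w0 h i - ((j%:R - i%:R) * h) *: c|
    <= (j%:R - i%:R) * h * e.
Proof.
move=> h0; elim: j => [|j IH] ij.
  by move: ij; rewrite leqn0 => /eqP -> _; rewrite !subrr !mul0r scale0r subrr normr0.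
move: ij; rewrite leq_eqVlt => /predU1P[-> _|]; first by rewrite !subrr !mul0r scale0r subrr normr0.
rewrite ltnS => ij Hc.
have {IH}IHj : `|euler H w0 h j - euler H w0 h i - ((j%:R - i%:R) * h) *: c|
    <= (j%:R - i%:R) * h * e.
  by apply: IH => // l /andP[il /ltnW lj]; apply: Hc; rewrite il ltnS.
have cj : `|H (j%:R * h, euler H w0 h j) - c| <= e by apply: Hc; rewrite ij ltnSn.
rewrite /= -natr1; set x := euler _ _ _ j in IHj cj *; set y := euler _ _ _ i in IHj *.
set z := H _ in cj *.
have -> : x + h *: z - y - ((j%:R + 1 - i%:R) * h) *: c =
   (x - y - ((j%:R - i%:R) * h) *: c) + h *: (z - c).
  apply/matrixP => p q; rewrite !mxE; ring.
apply: (le_trans (ler_normD _ _)); rewrite normrZ (ger0_norm h0).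
have -> : (j%:R + 1 - i%:R) * h * e = (j%:R - i%:R) * h * e + h * e :> R by ring.
by rewrite lerD// ler_wpM2l.
Qed.

Lemma euler_lipschitz {R : realType} {n : nat} (H : R * 'cV[R]_n -> 'cV[R]_n)
    (w0 : 'cV[R]_n) (h T K : R) (i j : nat) :
  0 <= h -> (i <= j)%N -> j%:R * h <= T ->
  (forall t v, 0 <= t <= T -> `|H (t, v)| <= K) ->
  `|euler H w0 h j - euler H w0 h i| <= (j%:R - i%:R) * h * K.
Proof.
move=> h0 ij jT HK.
have := @euler_increment R n H w0 h 0 K i j h0 ij.
rewrite scaler0 subr0; apply => l /andP[_ lj]; rewrite subr0; apply: HK.
rewrite mulr_ge0//= (le_trans _ jT)// ler_wpM2r// ler_nat; exact: ltnW.
Qed.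

Lemma truncn_grid {R : realType} (k : nat) (t : R) : 0 <= t ->
  (Num.truncn (t * k.+1%:R))%:R * k.+1%:R^-1 <= t <
  (Num.truncn (t * k.+1%:R))%:R * k.+1%:R^-1 + k.+1%:R^-1.
Proof.
move=> t0; have k0 : 0 < k.+1%:R :> R by rewrite ltr0n.
have /truncn_itv/andP[lo hi] : 0 <= t * k.+1%:R by rewrite mulr_ge0.
rewrite ler_pdivrMr// lo/= -[X in _ < _ + X]mul1r -mulrDl natr1.
by rewrite ltr_pdivlMr.
Qed.

(** Peano's theorem, with a bound on [H] that is uniform in the state over bounded
    times, so that solutions cannot blow up.  The approximations are the step
    functions [u k] equal at time [t] to the Euler iterate, with step [1 / k.+1],
    of the last grid time before [t].  On a short interval around [t0] all the
    slopes used are close to [c = H (t0, W t0)], because the iterates move at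
    bounded speed; hence the increments of [u k] are close to multiples of [c],
    and so are those of the pointwise limit [W].  This gives [W' = H (t, W)]
    without any integral equation. *)
Lemma peano_global {R : realType} {n : nat} (H : R * 'cV[R]_n -> 'cV[R]_n)
    (K : R -> R) (w0 : 'cV[R]_n) :
  continuous H -> (forall T t v, 0 <= t <= T -> `|H (t, v)| <= K T) ->
  exists2 W : R -> 'cV[R]_n, W 0 = w0 & solution (fun t v => H (t, v)) W.
Proof.
move=> Hc HK.
(* With [`|t|] the pointwise bounds hold at negative times too, and the
   compactness argument can run over the whole line. *)
pose u (k : nat) (t : R) := euler H w0 k.+1%:R^-1 (Num.truncn (`|t| * k.+1%:R)).
have K_ge0 T : 0 <= T -> 0 <= K T.
  by move=> T0; apply: le_trans (HK T 0 0 _); rewrite ?lexx.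
have h_gt0 (k : nat) : 0 < k.+1%:R^-1 :> R by rewrite invr_gt0 ltr0n.
have u_bounded t : exists M, forall k, `|u k t| <= M.
  exists (`|t| * K `|t| + `|w0|) => k.
  have /andP[lo _] := truncn_grid k _ (normr_ge0 t).
  have := @euler_lipschitz R n H w0 k.+1%:R^-1 _ _ 0 _ (ltW (h_gt0 k)) (leq0n _)
    lo (HK _).
  rewrite -[euler _ _ _ (Num.truncn _)]/(u k t) subr0 /= => ukt.
  rewrite -[u k t](subrK w0) (le_trans (ler_normD _ _))// lerD2r (le_trans ukt)//.
  by rewrite ler_wpM2r// K_ge0.
have [W [U [UF ooU uW]]] := pointwise_ultra_limit u u_bounded.
exists W.
  have u0 k : u k 0 = w0.
    by rewrite /u normr0 mul0r truncn0.
  have : cst w0 @ U --> W 0.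
    by have := uW 0; under eq_fun do rewrite u0.
  by move=> /(cvg_unique (@norm_hausdorff _ _) ); apply; exact: cvg_cst.
move=> t0 t0_ge0; apply/is_derive_ge0P => e e_gt0.
set c := H (t0, W t0).
have [d d_gt0 Hd] : exists2 d, 0 < d &
    forall t v, `|t - t0| < d -> `|v - W t0| < d -> `|H (t, v) - c| <= e.
  have /cvgrPdist_le/(_ _ e_gt0)/nbhs_ballP[d/= d0 dP] := Hc (t0, W t0).
  exists d => // t v td vd; rewrite distrC; apply: dP.
  by split; rewrite -ball_normE/= distrC.
(* [kap] bounds the speed up to time [t0 + 1]; being at least 1, it makes [r]
   small enough for the bounds on the time and on the state together. *)
pose kap := K (t0 + 1) + 1.
have kap_ge1 : 1 <= kap by rewrite lerDr K_ge0// addr_ge0.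
have kap_gt0 : 0 < kap by exact: lt_le_trans kap_ge1.
pose r := d / (4 * kap).
have r_gt0 : 0 < r by rewrite divr_gt0// mulr_gt0.
have rkap : r * kap = d / 4 by rewrite /r; field; rewrite gt_eqF.
have rd : r <= d / 4 by rewrite -rkap ler_peMr// ltW.
have HT t v : 0 <= t <= t0 + 1 -> `|H (t, v)| <= kap.
  by move=> /HK Ht; rewrite (le_trans (Ht v))// lerDl.
(* The Euler scheme runs forward in time, so a left increment at [t0] is treated
   as the increment over an interval ending at [t0]. *)
suff main a b : 0 <= a -> a <= b -> b - a < Num.min 1 r -> t0 = a \/ t0 = b ->
    `|W b - W a - (b - a) *: c| <= e * (b - a).
  exists (Num.min 1 r); first by rewrite lt_min ltr01.
  move=> s s0; have [st|/ltW st] := leP t0 s.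
    by rewrite ger0_norm ?subr_ge0// => sr; apply: main => //; left.
  rewrite ler0_norm ?subr_le0// opprB => sr.
  have -> : W s - W t0 - (s - t0) *: c = - (W t0 - W s - (t0 - s) *: c).
    by apply/matrixP => p q; rewrite !mxE; ring.
  by rewrite normrN; apply: main => //; right.
move=> a0 ab; rewrite lt_min => /andP[ba1 bar] t0ab.
have bT : b <= t0 + 1 by case: t0ab => ->; lra.
have b0 : 0 <= b by exact: le_trans ab.
have approx eta : 0 < eta -> eta <= r ->
    `|W b - W a - (b - a) *: c| <= e * (b - a) + eta * (e + `|c| + 2).
  move=> eta0 etar.
  have near_u t : U [set k | `|W t - u k t| <= eta].
    by have /cvgrPdist_le := uW t; exact.
  have near_h : U [set k | k.+1%:R^-1 <= eta :> R].
    apply: ooU; have := @cvg_harmonic R.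
    move=> /cvgrPdist_le/(_ _ eta0); apply: filterS => k /=.
    by rewrite sub0r normrN ger0_norm// ltW.
  have [k [/= [ka kb] kh]] := filter_ex (filterI (filterI (near_u a) (near_u b)) near_h).
  have /andP[alo ahi] := truncn_grid k _ a0.
  have /andP[blo bhi] := truncn_grid k _ b0.
  move: ka kb; rewrite /u !ger0_norm//.
  set h := k.+1%:R^-1 in kh alo ahi blo bhi *.
  have h0 : 0 < h by exact: h_gt0.
  set i := Num.truncn (a * _) in alo ahi *.
  set j := Num.truncn (b * _) in blo bhi *.
  set wi := euler H w0 h i; set wj := euler H w0 h j => ka kb.
  have ij : (i <= j)%N by rewrite /i /j le_truncn// ler_wpM2r.
  (* All grid points between [a] and [b] lie where [H] is almost constant: the
     iterates are compared with the one at whichever endpoint is [t0]. *)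
  have slope l : (i <= l < j)%N -> `|H (l%:R * h, euler H w0 h l) - c| <= e.
    move=> /andP[il /ltnW lj].
    have il' : i%:R * h <= l%:R * h by rewrite ler_wpM2r ?ler_nat// ltW.
    have lj' : l%:R * h <= j%:R * h by rewrite ler_wpM2r ?ler_nat// ltW.
    apply: Hd.
      by rewrite ltr_norml; case: t0ab => ->; apply/andP; split; lra.
    have := @euler_lipschitz R n H w0 h (t0 + 1) kap i l (ltW h0) il _ HT.
    have := @euler_lipschitz R n H w0 h (t0 + 1) kap l j (ltW h0) lj _ HT.
    move=> /(_ (le_trans blo bT)) wlj /(_ (le_trans lj' (le_trans blo bT))) wil.
    have lei : (l%:R - i%:R) * h * kap <= (b - a + h) * kap.
      by rewrite ler_wpM2r// ?(ltW kap_gt0)//; lra.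
    have lej : (j%:R - l%:R) * h * kap <= (b - a + h) * kap.
      by rewrite ler_wpM2r// ?(ltW kap_gt0)//; lra.
    have small : (b - a + h) * kap < d / 2.
      have -> : d / 2 = (r + r) * kap by rewrite mulrDl rkap; lra.
      by rewrite ltr_pM2r//; lra.
    case: t0ab => ->.
      rewrite -(subrK wi (euler H w0 h l)) -addrA.
      by rewrite (le_lt_trans (ler_normD _ _))// [X in _ + X]distrC; lra.
    rewrite -(subrK wj (euler H w0 h l)) -addrA (le_lt_trans (ler_normD _ _))//.
    by rewrite [X in _ + X]distrC [X in X + _]distrC; lra.
  have := @euler_increment R n H w0 h c e i j (ltW h0) ij slope.
  rewrite -/wi -/wj => incr.
  (* The number of steps times [h] differs from [b - a] by at most [h]. *)
  have -> : W b - W a - (b - a) *: c =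
      (W b - wj) + (wj - wi - ((j%:R - i%:R) * h) *: c)
      + (wi - W a) + ((j%:R - i%:R) * h - (b - a)) *: c.
    by apply/matrixP => p q; rewrite !mxE; ring.
  have grid : `|(j%:R - i%:R) * h - (b - a)| <= h.
    by rewrite ler_norml; apply/andP; split; lra.
  have gridc : `|((j%:R - i%:R) * h - (b - a)) *: c| <= h * `|c|.
    by rewrite normrZ ler_wpM2r.
  have incr' : (j%:R - i%:R) * h * e <= (b - a + h) * e.
    by rewrite ler_wpM2r ?(ltW e_gt0)//; lra.
  have eh : h * (e + `|c|) <= eta * (e + `|c|).
    by rewrite ler_wpM2r// addr_ge0// ltW.
  apply: (le_trans (ler_normD _ _)).
  apply: (le_trans (lerD (ler_normD _ _) (lexx _))).
  apply: (le_trans (lerD (lerD (ler_normD _ _) (lexx _)) (lexx _))).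
  rewrite [X in _ + X + _]distrC.
  clear - ka kb incr incr' gridc eh kh.
  lra.
apply/ler_addgt0Pr => x x0.
have s_gt0 : 0 < e + `|c| + 2 by rewrite ltr_wpDl// addr_ge0// ltW.
have := approx (Num.min r (x / (e + `|c| + 2))).
rewrite lt_min r_gt0 divr_gt0// ge_min lexx => /(_ isT isT) /le_trans; apply.
rewrite lerD2l -ler_pdivlMr// ge_min lexx orbT//.
Qed.

(** * The evolution operator *)

Lemma eq_mulmx_cV {R : realType} {n : nat} (M N : 'M[R]_n) :
  (forall v : 'cV[R]_n, M *m v = N *m v) -> M = N.
Proof.
move=> h; apply/matrixP => i j.
have := h (delta_mx j 0); rewrite -!colE => /matrixP/(_ i 0).
by rewrite !mxE.
Qed.

Section evolution.
Context {R : realType} {n : nat} {A : R -> R -> 'M[R]_n} {tp : R}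
  {Phi : R -> R -> 'M[R]_n} (Phi_evol : is_evolution_operator A tp Phi).

Lemma evolution_id (t : R) : 0 <= t -> Phi t t = 1%:M.
Proof.
move=> t0; apply: eq_mulmx_cV => v; case: Phi_evol => ex ev.
by have [V VP Vt] := ex t v t0; rewrite -[in LHS]Vt -(ev V VP)// Vt mul1mx.
Qed.

Lemma evolution_comp (t s r : R) : 0 <= t -> 0 <= s -> 0 <= r ->
  Phi t s *m Phi s r = Phi t r.
Proof.
move=> t0 s0 r0; apply: eq_mulmx_cV => v; case: Phi_evol => ex ev.
have [V VP Vr] := ex r v r0.
by rewrite -mulmxA -Vr -!(ev V VP).
Qed.

Lemma evolution_unit (t s : R) : 0 <= t -> 0 <= s -> Phi t s \in unitmx.
Proof.
move=> t0 s0; have := evolution_comp _ _ _ t0 s0 t0.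
by rewrite evolution_id// => /mulmx1_unit[].
Qed.

Lemma evolution_inv (t s : R) : 0 <= t -> 0 <= s -> Phi t s = invmx (Phi s t).
Proof.
move=> t0 s0; have st := evolution_unit s t s0 t0.
by rewrite -[LHS](mulmxK st) evolution_comp// evolution_id// mul1mx.
Qed.

Lemma evolution_derive (s t : R) (v : 'cV[R]_n) : 0 <= s -> 0 <= t ->
  is_derive_ge0 (fun r => Phi r s *m v) t (- (A t tp *m (Phi t s *m v))).
Proof.
move=> s0 t0; case: Phi_evol => ex ev; have [V VP Vs] := ex s v s0.
rewrite -Vs -(ev V VP t s)//; apply: eq_is_derive_ge0 (VP t t0) => // r r0.
by rewrite -!(ev V VP).
Qed.

(** The columns of [Phi t s] are solutions of the linear system. *)
Lemma evolution_continuous (s : R) : 0 <= s ->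
  continuous (fun t : R => Phi (Num.max t 0) s).
Proof.
move=> s0 t; apply/cvg_mxP => i j.
pose f (r : R) := Phi r s *m (delta_mx j 0 : 'cV[R]_n).
have /(_ t)/cvg_mxP/(_ i 0) : continuous (fun r : R => f (Num.max r 0)).
  by apply: is_derive_ge0_continuous => r r0; eexists; exact: evolution_derive.
by rewrite /f -colE mxE; under eq_fun do rewrite -colE mxE.
Qed.

Lemma evolution_continuousr (s : R) : 0 <= s ->
  continuous (fun t : R => Phi s (Num.max t 0)).
Proof.
have m0 (r : R) : 0 <= Num.max r 0 by exact: max_ge0.
move=> s0 t; under eq_fun do rewrite (evolution_inv s)//.
apply: cvg_invmx; last exact: (evolution_continuous s s0).
  by move=> r; exact: evolution_unit.
exact: evolution_unit.
Qed.

(** Only [Phi r t] is differentiable in [r] by definition.  Write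
    [Phi s r v = Phi s r (v - Phi r t v) + Phi s t v]: the factor
    [v - Phi r t v] vanishes at [r = t], where the Leibniz rule then asks only for the
    continuity of [Phi s]. *)
Lemma evolution_derive_r (s t : R) (v : 'cV[R]_n) : 0 <= s -> 0 <= t ->
  is_derive_ge0 (fun r => Phi s r *m v) t (Phi s t *m (A t tp *m v)).
Proof.
move=> s0 t0.
pose y r := v - Phi r t *m v.
have yt : y t = 0 by rewrite /y evolution_id// mul1mx subrr.
have dy : is_derive_ge0 y t (A t tp *m v).
  have /is_derive_ge0P d := evolution_derive t t v t0 t0.
  apply/is_derive_ge0P => e /d[r r0 rP]; exists r => // x x0 /(rP x x0).
  rewrite evolution_id// mul1mx yt subr0 -normrN; congr (`|_| <= _).
  by apply/matrixP => i j; rewrite !mxE; ring.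
have := @is_derive_ge0_mulmx _ _ (Phi s) y t 0 _ t0 (evolution_continuousr s s0) _ dy.
rewrite add0r => d; apply: eq_is_derive_ge0 (d _) => // [r r0|].
  rewrite yt mulmx0 subr0 /y mulmxBr mulmxA evolution_comp//.
apply/is_derive_ge0P => e e0; exists 1 => // r _ _.
by rewrite yt !mulmx0 scaler0 !subrr normr0 mulr_ge0// ltW.
Qed.
End evolution.

(** * The perturbed system *)

(** [V t = Phi t 0 *m W t] solves the perturbed system as soon as
    [W' = Phi 0 t *m F (t, Phi t 0 *m W)], by the Leibniz rule.  The matrix [A], which
    may be discontinuous in time, has disappeared from this equation, whose
    right-hand side is continuous and bounded over bounded times. *)
Lemma perturbed_solution_exists {R : realType} {n : nat} {A : R -> R -> 'M[R]_n}
    {tp : R} {Phi : R -> R -> 'M[R]_n} (F : R * 'cV[R]_n -> 'cV[R]_n) (M : R) (v0 : 'cV[R]_n) :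
  is_evolution_operator A tp Phi -> continuous F ->
  (forall t v, 0 <= t -> `|F (t, v)| <= M) ->
  exists2 V, V 0 = v0 & solution (perturbed_rhs A tp F) V.
Proof.
move=> ev F_cont FM.
have X_cont := evolution_continuous ev 0 (lexx 0).
have Y_cont := evolution_continuousr ev 0 (lexx 0).
pose H (p : R * 'cV[R]_n) :=
  Phi 0 (Num.max p.1 0) *m F (p.1, Phi (Num.max p.1 0) 0 *m p.2).
have H_cont : continuous H.
  move=> p; rewrite /continuous_at /H; apply: cvg_mulmx.
    exact: (@cvg_comp _ _ _ fst _ _ (nbhs p.1) _ cvg_fst (Y_cont p.1)).
  pose g (q : R * 'cV[R]_n) := (q.1, Phi (Num.max q.1 0) 0 *m q.2).
  apply: (@cvg_comp _ _ _ g F _ (nbhs (g p))); last exact: F_cont.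
  apply: (@cvg_pair _ _ _ (nbhs p) (nbhs p.1) (nbhs (Phi (Num.max p.1 0) 0 *m p.2))
    _ _ _ fst (fun q => Phi (Num.max q.1 0) 0 *m q.2)); first exact: cvg_fst.
  apply: cvg_mulmx; last exact: cvg_snd.
  exact: (@cvg_comp _ _ _ fst _ _ (nbhs p.1) _ cvg_fst (X_cont p.1)).
have /choice[K HK] : forall T : R, exists k : R,
    forall t v, 0 <= t <= T -> `|H (t, v)| <= k.
  move=> T; have [T0|T0] := leP 0 T; last first.
    exists 0 => t v /andP[t0 tT].
    by have := le_lt_trans (le_trans t0 tT) T0; rewrite ltxx.
  have [||c _ cmax] := @EVT_max R (fun t => `|Phi 0 (Num.max t 0)|) 0 T => //.
    by apply: continuous_subspaceT => t; apply: cvg_norm; exact: Y_cont.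
  exists (n%:R * `|Phi 0 (Num.max c 0)| * M) => t v /andP[t0 tT].
  rewrite /H/= (le_trans (mx_norm_mulmx_le _ _))// ler_pM ?mulr_ge0 ?FM//.
  by rewrite ler_wpM2l// cmax// in_itv/= t0.
have [W W0 WP] := peano_global H K v0 H_cont HK.
exists (fun t => Phi t 0 *m W t); first by rewrite W0 (evolution_id ev)// mul1mx.
move=> t t0.
have d := evolution_derive ev 0 t (W t) (lexx 0) t0.
have := is_derive_ge0_mulmx _ _ _ _ _ t0 X_cont d (WP t t0).
rewrite /H/= !max_l// [X in _ + X]mulmxA (evolution_comp ev)// (evolution_id ev)// mul1mx.
exact.
Qed.

(** The variation of constants formula in differential form: the contributions of
    [A] from the two factors cancel. *)
Lemma variation_of_constants {R : realType} {n : nat} {A : R -> R -> 'M[R]_n}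
    {tp : R} {Phi : R -> R -> 'M[R]_n} {F : R * 'cV[R]_n -> 'cV[R]_n}
    {V : R -> 'cV[R]_n} (T t : R) :
  is_evolution_operator A tp Phi -> solution (perturbed_rhs A tp F) V ->
  0 <= T -> 0 <= t ->
  is_derive_ge0 (fun s => Phi T s *m V s) t (Phi T t *m F (t, V t)).
Proof.
move=> ev Vsol T0 t0.
have := is_derive_ge0_mulmx _ _ _ _ _ t0 (evolution_continuousr ev T T0)
  (evolution_derive_r ev T t (V t) T0 t0) (Vsol t t0).
by rewrite -mulmxDr addNKr.
Qed.

(** Let [Z s = Phi T s V(s)], which runs from [Phi T 0 V(0)] to [V T]; its speed is
    at most [M D (c g(s)) ^ alpha], where [g s = mu 1 1 0 s], [c = mu 1 1 T 0] and
    [mu 1 1 T s = c g(s)] by the cocycle property.  As [g <= g'], this speed is at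
    most the derivative of [D M / alpha (c g(s)) ^ alpha], a positive function
    with value [D M / alpha] at [s = T] since [c g(T) = 1].  Norms need not be
    differentiable, so the comparison is made for the component of [Z] along
    [e = V T], which suffices because it equals [enorm e ^ 2] at time [T]. *)
Lemma contraction_bound {R : realType} {n : nat} {tp alpha D : R}
    {A : R -> R -> 'M[R]_n} {Phi : R -> R -> 'M[R]_n} {mu : R -> R -> R -> R -> R}
    {F : R * 'cV[R]_n -> 'cV[R]_n} {M : R} (V : R -> 'cV[R]_n) (T : R) :
  0 < alpha -> 0 < D -> mu_positive mu -> mu_cocycle mu ->
  is_evolution_operator A tp Phi -> mu_contraction Phi mu alpha D ->
  (forall t v, 0 <= t -> enorm (F (t, v)) <= M) -> 0 < M ->
  solution (perturbed_rhs A tp F) V -> 0 <= T ->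
  enorm (V T) <= mu alpha D T 0 * enorm (V 0) + D * M / alpha.
Proof.
move=> alpha0 D0 mu_pos [muE mu_comp mu_der] ev contr FM M0 Vsol T0.
pose g : R -> R := mu 1 1 0; pose c := mu 1 1 T 0.
have c0 : 0 < c by exact: mu_pos.
have g0 t : 0 <= t -> 0 < g t by move=> t0; exact: mu_pos.
have muT t : 0 <= t -> mu alpha D T t = D * (c * g t) `^ alpha.
  by move=> t0; rewrite muE// -(mu_comp T 0 t).
have cgT : c * g T = 1.
  rewrite /c /g mu_comp//; have := mu_comp T T T T0 T0 T0.
  have m0 : mu 1 1 T T != 0 by rewrite gt_eqF// mu_pos.
  by move=> /(canRL (mulfK m0)); rewrite mulfV.
pose e := V T; pose Z s := Phi T s *m V s.
have ZT : Z T = e by rewrite /Z (evolution_id ev)// mul1mx.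
pose C := D * M / alpha.
have C0 : 0 < C by rewrite divr_gt0// mulr_gt0.
pose h s := C * enorm e * (c * g s) `^ alpha - dot e (Z s).
have dZ t : 0 <= t -> is_derive_ge0 Z t (Phi T t *m F (t, V t)).
  by move=> t0; exact: variation_of_constants ev Vsol T0 t0.
have h_cont : continuous (fun s : R => h (Num.max s 0)).
  have gc : continuous (fun s : R => g (Num.max s 0)).
    apply: (@is_derive_ge0_continuous _ R^o) => t t0.
    by have [l dl _] := mu_der t t0; exists l.
  have Zc : continuous (fun s : R => dot e (Z (Num.max s 0))).
    apply: (@is_derive_ge0_continuous _ R^o (fun s => dot e (Z s))) => t t0.
    by eexists; apply: is_derive_ge0_dot; exact: dZ.
  move=> t; apply: cvgB; last exact: Zc.
  apply: cvgMr; apply: cvg_powR; first by rewrite mulr_gt0// g0// max_ge0.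
  by apply: cvgMr; exact: gc.
have h_mono : h 0 <= h T.
  apply: ge0_derive_le => // t t_gt0 tT; have t0 := ltW t_gt0.
  have [l dl l_ge] := mu_der t t0.
  have gl : g t <= l by move: l_ge; rewrite ler_pdivlMr ?mul1r// g0.
  have cg0 : 0 < c * g t by rewrite mulr_gt0// g0.
  have d1 : is_derive t 1 g l by exact: is_derive_ge0_is_derive.
  have d2 : is_derive t 1 (fun s => c * g s) (c * l) by exact: is_deriveZ.
  have d3 := is_derive_powR_comp (fun s => c * g s) alpha t _ cg0 d2.
  have d4 : is_derive t 1 (fun s => dot e (Z s)) (dot e (Phi T t *m F (t, V t))).
    by apply: is_derive_ge0_is_derive => //; apply: is_derive_ge0_dot; exact: dZ.
  eexists; first exact: (is_deriveB (is_deriveZ (C * enorm e) d3) d4).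
  rewrite subr_ge0 -[X in _ <= X]/(_ * _).
  have F_le : dot e (Phi T t *m F (t, V t)) <= enorm e * (D * (c * g t) `^ alpha * M).
    rewrite (le_trans (dot_le _ _))// ler_wpM2l ?enorm_ge0//.
    rewrite (le_trans (enorm_opnorm_le _ _))// -muT//.
    apply: (@le_trans _ _ (mu alpha D T t * enorm (F (t, V t)))).
      by rewrite ler_wpM2r ?enorm_ge0// contr// ltW.
    by rewrite ler_wpM2l ?FM// ltW// mu_pos.
  apply: (le_trans F_le); rewrite -(mulr_powRB1 (ltW cg0) alpha0).
  set p := _ `^ _; have p0 : 0 <= p by exact: powR_ge0.
  have -> : C * enorm e * (alpha * p * (c * l)) = enorm e * (D * (c * l * p) * M).
    by rewrite /C; field; rewrite gt_eqF.
  rewrite ler_wpM2l ?enorm_ge0// ler_wpM2r ?(ltW M0)// ler_wpM2l ?(ltW D0)//.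
  by rewrite ler_wpM2r// ler_wpM2l// ltW.
move: h_mono; rewrite /h cgT powR1 mulr1 ZT dot_self.
have [e0|e0] := eqVneq (enorm e) 0.
  by move=> _; rewrite -/e e0 addr_ge0 ?(ltW C0)// mulr_ge0 ?enorm_ge0// ltW// mu_pos.
have e_gt0 : 0 < enorm e by rewrite lt_def e0 enorm_ge0.
have p0 : 0 <= (c * g 0) `^ alpha by exact: powR_ge0.
have Z0 : dot e (Z 0) <= enorm e * (mu alpha D T 0 * enorm (V 0)).
  rewrite (le_trans (dot_le _ _))// ler_wpM2l ?enorm_ge0//.
  rewrite (le_trans (enorm_opnorm_le _ _))// ler_wpM2r ?enorm_ge0//.
  exact: contr.
have q0 : 0 <= C * enorm e * (c * g 0) `^ alpha.
  by rewrite mulr_ge0// mulr_ge0 ?enorm_ge0// ltW.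
by move=> hh; rewrite -/e -/C -(ler_pM2l e_gt0) mulrDr; lra.
Qed.

Lemma limf_esup_le {R : realType} (f g : R -> R) (c : R) :
  (forall t, 0 <= t -> f t <= g t + c) -> g t @[t --> +oo] --> (0 : R) ->
  (limf_esup (fun t => (f t)%:E) (+oo%R : set_system R) <= c%:E)%E.
Proof.
move=> fg g0; apply/lee_addgt0Pr => e e0; rewrite limf_esupE.
have near_f : \forall t \near +oo%R, f t <= c + e.
  move/cvgrPdist_le : g0 => /(_ e e0) g0; near=> t.
  have t0 : 0 <= t by near: t; exact: nbhs_pinfty_ge.
  have : `|0 - g t| <= e by near: t.
  rewrite sub0r normrN => /(le_trans (ler_norm _)) gt.
  by rewrite (le_trans (fg _ t0))// addrC lerD2l.
apply: (@le_trans _ _ (ereal_sup ((fun t => (f t)%:E) @` [set t | f t <= c + e]))).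
  by apply: ereal_inf_lbound; exists [set t | f t <= c + e].
by apply: ge_ereal_sup => _ [t /= ft <-]; rewrite -EFinD lee_fin.
Unshelve. all: by end_near. Qed.

Theorem theorem4 (R : realType) (n : nat) (tp alpha D eps : R)
    (A : R -> R -> 'M[R]_n) (Phi : R -> R -> 'M[R]_n)
    (mu : R -> R -> R -> R -> R)
    (F : R * 'cV[R]_n -> 'cV[R]_n) (Mhat : R)
    (tp_gt0 : 0 < tp) (alpha_gt0 : 0 < alpha) (D_gt0 : 0 < D)
    (eps_gt0 : 0 < eps)
    (mu_pos : mu_positive mu)
    (B1 : mu_decay_monotone mu)
    (B2 : mu_small_after mu alpha D tp eps)
    (B3 : mu_cocycle mu)
    (Phi_evol : is_evolution_operator A tp Phi)
    (Phi_contr : mu_contraction Phi mu alpha D)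
    (F_cont : continuous F)
    (Mhat_gt0 : 0 < Mhat)
    (F_bound : forall t v, 0 <= t -> enorm (F (t, v)) <= Mhat) :
  (exists2 V : R -> 'cV[R]_n, solution (perturbed_rhs A tp F) V
     & exists C : R, forall t, 0 <= t -> enorm (V t) <= C) /\
  (forall V : R -> 'cV[R]_n, solution (perturbed_rhs A tp F) V ->
     (limf_esup (fun t => (enorm (V t))%:E) (+oo%R : set_system R)
        <= (D * Mhat / alpha)%:E)%E).
Proof.
have bound V t : solution (perturbed_rhs A tp F) V -> 0 <= t ->
    enorm (V t) <= mu alpha D t 0 * enorm (V 0) + D * Mhat / alpha.
  by move=> Vsol; exact: contraction_bound Phi_evol Phi_contr F_bound Mhat_gt0 Vsol.
have [mu_cvg0 mu_decr _ _] := B1; split.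
  have F_bound' t v : 0 <= t -> `|F (t, v)| <= Mhat.
    by move=> t0; exact: le_trans (mx_norm_le_enorm _) (F_bound t v t0).
  have [V _ Vsol] := perturbed_solution_exists F Mhat 0 Phi_evol F_cont F_bound'.
  exists V => //; exists (mu alpha D 0 0 * enorm (V 0) + D * Mhat / alpha) => t t0.
  rewrite (le_trans (bound V t Vsol t0))// lerD2r ler_wpM2r ?enorm_ge0//.
  exact: mu_decr.
move=> V Vsol.
apply: (@limf_esup_le _ _ (fun t => mu alpha D t 0 * enorm (V 0))) => [t t0|].
  exact: bound.
rewrite -[X in _ --> X](mul0r (enorm (V 0))).
by apply: cvgM; [exact: mu_cvg0|exact: cvg_cst].
Qed.
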